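(* Let $R$ be a locally compact Hausdorff space, let $k\ge 1$ be an integer, and let $\Phi$ be a capacity on the class $\mathcal{K}$ of compact subsets of $R$ which is a $k$-valuation. Let $\lambda$ be the Radon measure on $\mathcal{F}'$ satisfying $\Phi(Q)=\lambda(\{F\in\mathcal{F}': Q\cap F\neq\varnothing\})$ for all $Q\in\mathcal{K}$ (it exists and is unique because $\Phi$ is completely alternating). Then $\lambda$ is supported by $\mathcal{P}_k'=\{A\in\mathcal{F}': 1\le |A|\le k\}$, that is, $\lambda(\mathcal{F}'\setminus\mathcal{P}_k')=0$.
   Context: $\mathcal{F}'$ is the space of nonempty closed subsets of $R$ with the Fell topology, whose subbase consists of the sets $\{F: F\cap Q=\varnothing\}$ ($Q\in\mathcal{K}$) and $\{F: F\cap G\ne\varnothing\}$ ($G\subseteq R$ open); it is locally compact Hausdorff. A Radon measure is a Borel measure, finite on compact sets, inner regular on open sets and outer regular on Borel sets. A capacity is a function $\Phi:\mathcal{K}\to[0,\infty)$ with $\Phi(\varnothing)=0$ that is increasing ($\Phi(E)\le\Phi(F)$ if $E\subseteq F$) and continuous on the right: for every $E\in\mathcal{K}$ and $\varepsilon>0$ there is an open $G\supseteq E$ with $|\Phi(F)-\Phi(E)|<\varepsilon$ whenever $F\in\mathcal{K}$, $E\subseteq F\subseteq G$. It need not be bounded. Put $\nabla_{Q_1}\Phi(Q)=\Phi(Q)-\Phi(Q\cup Q_1)$ and $\nabla_{Q_1,\ldots,Q_n}\Phi=\nabla_{Q_n}(\nabla_{Q_1,\ldots,Q_{n-1}}\Phi)$.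 $\Phi$ is completely alternating if $\nabla_{Q_1,\ldots,Q_n}\Phi(Q)\le 0$ for all $n\ge1$ and $Q,Q_1,\ldots,Q_n\in\mathcal{K}$. $\Phi$ is a $k$-valuation if it is completely alternating and $\nabla_{Q_1,\ldots,Q_{k+1}}\Phi\bigl(\bigcup_{i\ne j}Q_i\cap Q_j\bigr)=0$ for every $(k+1)$-tuple $Q_1,\ldots,Q_{k+1}$ of $\mathcal{K}$. *)

(* Defs.v *)
From HB Require Import structures.
From mathcomp Require Import all_boot all_order all_algebra.
From mathcomp Require Import all_classical all_reals all_analysis.

Set Implicit Arguments.
Unset Strict Implicit.
Unset Printing Implicit Defensive.

Import Order.TTheory GRing.Theory Num.Theory.
Import numFieldNormedType.Exports.

Local Open Scope classical_set_scope.
Local Open Scope ring_scope.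
Local Open Scope card_scope.

Record closed_nonempty (X : topologicalType) := ClosedNonempty {
  elements : set X ;
  closed_elements : closed elements ;
  elements_neq0 : elements !=set0 }.

HB.instance Definition _ (X : topologicalType) :=
  gen_eqMixin (closed_nonempty X).
HB.instance Definition _ (X : topologicalType) :=
  gen_choiceMixin (closed_nonempty X).

Definition fell_subbase (X : topologicalType) :
    set (set (closed_nonempty X)) :=
  [set [set F | elements F `&` Q = set0] | Q in [set Q : set X | compact Q]]
  `|`
  [set [set F | elements F `&` G !=set0] | G in [set G : set X | open G]].

HB.instance Definition _ (X : topologicalType) :=
  isSubBaseTopological.Build (closed_nonempty X) (@fell_subbase X) id.

(* The library's measurable types are pointed; the whole space is an element
   of closed_nonempty X as soon as X is inhabited. *)
HB.instance Definition _ (X : ptopologicalType) :=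
  isPointed.Build (closed_nonempty X)
    (ClosedNonempty (@closedT X) (ex_intro _ point I)).

(* Meant for Hausdorff T, where compact sets are Borel: on a non-measurable
   set, the value of a library measure is meaningless. *)
Definition radon (R : realType) (T : ptopologicalType)
    (mu : {measure set (g_sigma_algebraType (@open T)) -> \bar R}) : Prop :=
  [/\ forall K : set T, compact K -> (mu K < +oo)%E,
      forall U : set T, open U ->
        mu U = ereal_sup [set mu K | K in [set K : set T |
                                            compact K /\ K `<=` U]] &
      forall B : set T, (@open T).-sigma.-measurable B ->
        mu B = ereal_inf [set mu U | U in [set U : set T |
                                            open U /\ B `<=` U]]].

(* Set functions on compact sets are total functions set X -> R, of which only
   the values at compact sets matter. *)
Record capacity (R : realType) (X : topologicalType) (Phi : set X -> R) :
    Prop := Capacity {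
  capacity_ge0 : forall Q, compact Q -> 0 <= Phi Q ;
  capacity0 : Phi set0 = 0 ;
  capacity_le : forall E F, compact E -> compact F -> E `<=` F ->
    Phi E <= Phi F ;
  capacity_right_continuous : forall E, compact E ->
    forall e : R, 0 < e -> exists G, [/\ open G, E `<=` G &
      forall F, compact F -> E `<=` F -> F `<=` G ->
        `|Phi F - Phi E| < e] }.

Definition nabla1 (R : realType) (X : Type) (Phi : set X -> R) (Q1 : set X) :
    set X -> R :=
  fun Q => Phi Q - Phi (Q `|` Q1).

Definition nabla (R : realType) (X : Type) (n : nat) (Qs : 'I_n -> set X)
    (Phi : set X -> R) : set X -> R :=
  foldl (@nabla1 R X) Phi [seq Qs i | i <- enum 'I_n].

Definition completely_alternating (R : realType) (X : topologicalType)
    (Phi : set X -> R) : Prop :=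
  forall (n : nat) (Q : set X) (Qs : 'I_n -> set X), (1 <= n)%N ->
    compact Q -> (forall i, compact (Qs i)) -> nabla Qs Phi Q <= 0.

Definition pairwise_overlap (X : Type) (n : nat) (Qs : 'I_n -> set X) :
    set X :=
  \bigcup_(p in [set p : 'I_n * 'I_n | p.1 != p.2]) (Qs p.1 `&` Qs p.2).

Definition k_valuation (R : realType) (X : topologicalType) (k : nat)
    (Phi : set X -> R) : Prop :=
  completely_alternating Phi /\
  forall Qs : 'I_k.+1 -> set X, (forall i, compact (Qs i)) ->
    nabla Qs Phi (pairwise_overlap Qs) = 0.

Definition card_1_to_k (X : topologicalType) (k : nat) :
    set (closed_nonempty X) :=
  [set A | `I_1 #<= elements A /\ elements A #<= `I_k].
Arguments card_1_to_k X k : clear implicits.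

(* Main.v *)
Require Import Defs.
From mathcomp Require Import all_boot all_order all_algebra finmap.
From mathcomp Require Import all_classical all_reals all_analysis.
Import Order.TTheory GRing.Theory Num.Theory.
Import numFieldNormedType.Exports.
Local Open Scope classical_set_scope.
Local Open Scope ring_scope.

(** For compact Q, Q_1, ..., Q_n, inclusion-exclusion gives
    - nabla_{Q_1,...,Q_n} Phi (Q) =
      lambda {F : F misses Q and meets every Q_i}.
    A closed set with more than k points meets k+1 pairwise disjoint compact
    sets Q_i in their interiors. Their pairwise overlap is empty, so the
    valuation property makes the Fell neighbourhood {F : F meets every Q_i} a
    null set. Hence the complement of P_k' is an open set covered by null open
    sets, and inner regularity on open sets makes it null; the Fell space being
    Hausdorff, the compact sets involved there are Borel. *)

Definition hitting {X : topologicalType} (Q : set X) :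
    set (closed_nonempty X) :=
  [set F | Q `&` elements F !=set0].

(** * Finite cardinalities and disjoint compact neighbourhoods *)

Lemma card_le_ordP {T : pointedType} (n : nat) (A : set T) :
  (`I_n #<= A)%card -> exists2 f : 'I_n -> T, injective f & forall i, A (f i).
Proof.
move=> /pcard_leP[/= f]; exists (fun i : 'I_n => f i) => [i j fij|i].
  by apply: val_inj; apply: (@inj _ _ _ f) fij; rewrite inE /=.
by apply: (@funS _ _ _ _ f) => /=.
Qed.

Lemma injective_card_le {T : Type} (n : nat) (f : 'I_n -> T) (A : set T) :
  injective f -> (forall i, A (f i)) -> (`I_n #<= A)%card.
Proof.
move=> finj Af; rewrite (card_le_eql card_II).
rewrite -(card_le_eql (inj_card_eq (in2W finj))).
by apply: subset_card_le => _ [i _ <-].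
Qed.

Lemma card_gt_II {T : Type} (n : nat) (A : set T) :
  ~ (A #<= `I_n)%card -> (`I_n.+1 #<= A)%card.
Proof.
have [/finite_setP[m Am]|/infiniteP natA _] := pselect (finite_set A).
  rewrite (card_le_eql Am) (card_le_eqr Am) !card_le_II.
  by move/negP; rewrite -ltnNge.
by apply: card_le_trans natA; exact: card_leT.
Qed.

(** A compact neighbourhood [C] of [x] is regular in a Hausdorff space, so some closed neighbourhood
    of [x] fits inside [V]; cutting it down to [C] makes it compact. *)
Lemma locally_compact_nbhs {X : topologicalType} (x : X) (V : set X) :
  locally_compact [set: X] -> hausdorff_space X -> nbhs x V ->
  exists Q, [/\ compact Q, nbhs x Q & Q `<=` V].
Proof.
move=> lcX hX xV; have [C] := lcX x I; rewrite withinET => xC [cC _].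
have [N xN NV] := compact_regular hX cC xC xV.
exists (C `&` closure N); split.
- by apply: compact_closedI => //; exact: closed_closure.
- by apply: filterI => //; apply: filterS xN; exact: subset_closure.
- by move=> y [_ /NV].
Qed.

Lemma disjoint_compact_nbhs {X : topologicalType} (n : nat) (f : 'I_n -> X) :
  locally_compact [set: X] -> hausdorff_space X -> injective f ->
  exists Q : 'I_n -> set X, [/\ forall i, compact (Q i),
    forall i, nbhs (f i) (Q i) & forall i j, i != j -> Q i `&` Q j = set0].
Proof.
move=> lcX hX finj.
(* Ordered pairs of distinct points are separated by disjoint open sets; diagonal pairs get the
   whole space, which imposes no constraint. *)
have /choice[AB hAB] : forall p : 'I_n * 'I_n, exists AB : set X * set X,
    [/\ nbhs (f p.1) AB.1, nbhs (f p.2) AB.2 &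
        p.1 != p.2 -> AB.1 `&` AB.2 = set0].
  move=> [i j] /=; have [<-|ij] := eqVneq i j.
    by exists (setT, setT); split => //; exact: filterT.
  have fij : f i != f j by apply: contra_neq ij => /finj.
  move: hX; rewrite open_hausdorff => /(_ _ _ fij)[[A B] /=].
  rewrite !inE => -[Afi Bfj] [oA oB AB0].
  exists (A, B); split=> [||_]; last exact: AB0.
  - exact: open_nbhs_nbhs.
  - exact: open_nbhs_nbhs.
(* [Q i] is confined to both its sides, as first and as second index: for [i != j], [Q i] and [Q j]
   then lie in the two disjoint halves of [AB (i, j)]. *)
have /choice[Q hQ] : forall i, exists Q, [/\ compact Q, nbhs (f i) Q &
    Q `<=` [set x | forall j, (AB (i, j)).1 x /\ (AB (j, i)).2 x]].
  move=> i; apply: locally_compact_nbhs => //.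
  apply: filter_forall => j; apply: filterI.
  - by have [] := hAB (i, j).
  - by have [] := hAB (j, i).
exists Q; split => [i|i|i j ij]; [by have [] := hQ i|by have [] := hQ i|].
rewrite -subset0 => x [Qix Qjx].
have [_ _ /(_ x Qix j)[Ax _]] := hQ i; have [_ _ /(_ x Qjx i)[_ Bx]] := hQ j.
by have [_ _ /(_ ij) <-] := hAB (i, j).
Qed.

(** * Topology of the Fell space *)

Section Fell.
Variable X : topologicalType.
Implicit Types F G : closed_nonempty X.

Lemma fell_subbase_open (S : set (closed_nonempty X)) :
  fell_subbase S -> open S.
Proof.
move=> sbS; exists [set S]; last first.
  by rewrite predeqE => ?; split=> [[_ ->]|] //; exists S.
move=> _ ->; exists [fset S]%fset; first by move=> ?; rewrite !inE => ->.
by rewrite predeqE => ?; split=> [|? ?]; [apply|]; rewrite /= inE // => /eqP->.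
Qed.

Lemma hitting_open (Q : set X) : open Q -> open (hitting Q).
Proof.
move=> oQ; apply: fell_subbase_open; right; exists Q => //=.
by apply/seteqP; split=> F /=; rewrite /hitting /= setIC.
Qed.

Lemma missing_open (Q : set X) : compact Q -> open (~` hitting Q).
Proof.
move=> cQ; apply: fell_subbase_open; left; exists Q => //=.
by apply/seteqP; split=> F; rewrite /hitting /= setIC;
  [move=> -> []|move/set0P/negP/negPn/eqP].
Qed.

Lemma hittingU (Q Q' : set X) : hitting (Q `|` Q') = hitting Q `|` hitting Q'.
Proof.
apply/seteqP; split=> F.
- by move=> [x [[] ? ?]]; [left|right]; exists x.
- by case=> -[x [? ?]]; exists x; split=> //; [left|right].
Qed.

Lemma hitting_nbhs F x (Q : set X) : elements F x -> nbhs x Q -> nbhs F (hitting Q).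
Proof.
move=> Fx xQ.
have : nbhs F (hitting Q°).
  apply: open_nbhs_nbhs; split; first exact/hitting_open/open_interior.
  by exists x.
by apply: filterS => G [y [/interior_subset ? ?]]; exists y.
Qed.

Lemma closed_nonempty_ext F G : elements F = elements G -> F = G.
Proof.
by case: F G => [A cA A0] [B cB B0] /= AB; subst B; f_equal;
  exact: Prop_irrelevance.
Qed.

Hypotheses (lcX : locally_compact [set: X]) (hX : hausdorff_space X).

(** Since [elements G] is closed, [x] has a compact neighbourhood [Q] that misses it; hitting and
    missing [Q] are then complementary neighbourhoods of [F] and [G]. *)
Lemma fell_separation F G x : elements F x -> ~ elements G x ->
  exists A B, [/\ nbhs F A, nbhs G B & A `&` B = set0].
Proof.
move=> Fx nGx.
have xG : nbhs x (~` elements G).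
  by apply: open_nbhs_nbhs; split=> //; exact/closed_openC/closed_elements.
have [Q [cQ xQ QG]] := locally_compact_nbhs _ _ lcX hX xG.
exists (hitting Q), (~` hitting Q); split; last exact: setICr.
- exact: hitting_nbhs xQ.
- apply: open_nbhs_nbhs; split; first exact: missing_open.
  by move=> [y [/QG]].
Qed.

Lemma fell_hausdorff : hausdorff_space (closed_nonempty X).
Proof.
move=> F G FG; apply: closed_nonempty_ext; apply: contrapT => neFG.
have [H|H] : (exists2 x, elements F x & ~ elements G x) \/
    (exists2 x, elements G x & ~ elements F x).
  apply: contrapT => /not_orP[H1 H2]; apply: neFG; apply/seteqP.
  by split=> x xF; apply: contrapT => xG; [apply: H1|apply: H2]; exists x.
- have [x Fx Gx] := H; have [A [B [FA GB AB0]]] := fell_separation _ _ _ Fx Gx.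
  by have := FG A B FA GB; rewrite AB0 => -[].
- have [x Gx Fx] := H; have [A [B [GA FB AB0]]] := fell_separation _ _ _ Gx Fx.
  by have := FG B A FB GA; rewrite setIC AB0 => -[].
Qed.

End Fell.

(** * Locally null open sets of a Radon measure *)

Section Borel.
Context {R : realType} {T : ptopologicalType}.

Lemma open_Borel (A : set (g_sigma_algebraType (@open T))) :
  open (A : set T) -> measurable A.
Proof. exact: sub_sigma_algebra. Qed.

Variable mu : {measure set (g_sigma_algebraType (@open T)) -> \bar R}.

Lemma radon_open_locally_null (U : set T) :
  hausdorff_space T -> radon mu -> open U ->
  (forall x, U x -> exists V : set T, [/\ open V, V x & mu V = 0%E]) ->
  mu U = 0%E.
Proof.
move=> hT [_ muU _] oU Unull; apply/eqP; rewrite eq_le measure_ge0 andbT.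
rewrite muU //; apply: ge_ereal_sup => _ [K [cK KU] <-].
have mK : measurable (K : set (g_sigma_algebraType (@open T))).
  rewrite -[K]setCK; apply: measurableC; apply: open_Borel.
  by apply: closed_openC; exact: compact_closed hT cK.
(* By compactness finitely many null open sets cover [K], and negligible sets are stable under
   subsets and finite unions. *)
suff /measure_negligible -> : mu.-negligible K by [].
move: cK; rewrite compact_cover.
move=> /(_ _ [set V : set T | open V /\ mu V = 0%E] id)[V []//|x Kx|D nullD].
  by have [V [? ? ?]] := Unull x (KU x Kx); exists V.
rewrite /cover bigcup_fset => KD.
apply: (@negligibleS _ (g_sigma_algebraType (@open T)) _ mu _ _ KD).
rewrite big_seq; elim/big_ind : _ => [|A B|V /nullD].
- exact: negligible_set0.
- exact: negligibleU.
- rewrite inE => -[oV V0]; exists V; split => //; exact: open_Borel.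
Qed.

End Borel.

(** * Inclusion-exclusion for the representing measure *)

Section Representation.
Context {R : realType} {X : ptopologicalType}.
Variables (Phi : set X -> R)
  (lambda : {measure set (g_sigma_algebraType (@open (closed_nonempty X)))
               -> \bar R}).
Hypothesis lambda_Phi :
  forall Q : set X, compact Q -> (Phi Q)%:E = lambda (hitting Q).

Let Borel_set := set (g_sigma_algebraType (@open (closed_nonempty X))).

Lemma hitting_Borel (Q : set X) : compact Q -> measurable (hitting Q : Borel_set).
Proof.
move=> cQ; rewrite -[hitting Q]setCK; apply: measurableC.
by apply: open_Borel; exact: missing_open.
Qed.

Lemma hitting_all_Borel (s : seq (set X)) : (forall Q, Q \in s -> compact Q) ->
  measurable (\bigcap_(Q in [set` s]) hitting Q : Borel_set).
Proof.
by move=> cs; apply: fin_bigcap_measurable => // Q /cs; exact: hitting_Borel.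
Qed.

(** Induction from the end of [s], the last difference being the outermost. The list must be
    nonempty: with no differences the left side is [Phi Q], the measure of [hitting Q] and not minus
    that of its complement. *)
Lemma foldl_nabla1_measure (s : seq (set X)) (Q : set X) :
  s != [::] -> (forall P, P \in s -> compact P) -> compact Q ->
  (foldl (@nabla1 R X) Phi s Q)%:E =
  (- lambda (~` hitting Q `&` \bigcap_(P in [set` s]) hitting P))%E.
Proof.
elim/last_ind : s Q => // s P IHs Q _ cs cQ.
have cP : compact P by apply: cs; rewrite mem_rcons mem_head.
have {}cs P' : P' \in s -> compact P'.
  by move=> sP'; apply: cs; rewrite mem_rcons inE sP' orbT.
have cQP : compact (Q `|` P) by exact: compactU.
have mQ := hitting_Borel _ cQ; have mP := hitting_Borel _ cP.
have mQP := hitting_Borel _ cQP; have ms := hitting_all_Borel _ cs.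
have lamDI (A B : Borel_set) : measurable A -> measurable B ->
    lambda A = (lambda (A `\` B) + lambda (A `&` B))%E.
  by move=> mA mB; exact: measureDI.
rewrite -cats1 foldl_cat /= {1}/nabla1 EFinB.
have -> : \bigcap_(P' in [set` s ++ [:: P]]) hitting P' =
    (\bigcap_(P' in [set` s]) hitting P') `&` hitting P :> Borel_set.
  apply/seteqP; split=> F.
    move=> FsP; split=> [P' sP'|]; apply: FsP => /=; rewrite mem_cat ?inE.
      by rewrite sP'.
    by rewrite eqxx orbT.
  by move=> [Fs FP] P' /=; rewrite mem_cat inE => /orP[/Fs|/eqP->].
(* A single difference: a set that meets [Q] or [P] either meets [Q], or misses [Q] and meets [P].
   The subtraction is legitimate because [Phi Q] is real. *)
have [s0|s0] := eqVneq s [::].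
  rewrite s0 /= EFinN !lambda_Phi // (lamDI _ _ mQP mQ).
  have -> : \bigcap_(P' in [set` [::]]) hitting P' = setT :> Borel_set.
    by apply/seteqP; split.
  have -> : hitting (Q `|` P) `&` hitting Q = hitting Q.
    by rewrite hittingU; apply/setIidPr => F; left.
  have -> : hitting (Q `|` P) `\` hitting Q = ~` hitting Q `&` hitting P.
    by rewrite hittingU setDUl setDv set0U setDE setIC.
  have fin_Q : lambda (hitting Q) \is a fin_num by rewrite -lambda_Phi.
  by rewrite setTI fin_num_oppeD // addeCA subee // adde0.
(* Sets that miss [Q] and meet all of [s] are split by whether they meet [P]; those missing [P] are
   the ones counted for [Q] enlarged by [P]. *)
rewrite !IHs //.
set A := \bigcap_(P' in _) _.
rewrite (lamDI _ _ (measurableI _ _ (measurableC mQ) ms) mP).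
have -> : (~` hitting Q `&` A) `\` hitting P = ~` hitting (Q `|` P) `&` A.
  by rewrite hittingU setCU setDE setIAC.
(* [lambda] may be infinite, but by induction this measure is minus a real number. *)
have fin_QP : lambda (~` hitting (Q `|` P) `&` A) \is a fin_num.
  by rewrite -fin_numN -IHs.
by rewrite -setIA oppeK (addeC (lambda _)) fin_num_oppeD // subeK.
Qed.

End Representation.

(** * Null neighbourhoods of closed sets with more than [k] points *)

Lemma more_than_k_null_nbhs {R : realType} {X : ptopologicalType}
    (k : nat) (Phi : set X -> R)
    (lambda : {measure set (g_sigma_algebraType (@open (closed_nonempty X)))
                 -> \bar R}) (F : closed_nonempty X) :
  locally_compact [set: X] -> hausdorff_space X -> k_valuation k Phi ->
  (forall Q, compact Q -> (Phi Q)%:E = lambda (hitting Q)) ->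
  (~` card_1_to_k X k) F ->
  exists V : set (closed_nonempty X),
    [/\ open V, V F, V `<=` ~` card_1_to_k X k & lambda V = 0%E].
Proof.
move=> lcX hX [_ Phi_k] lamPhi nF.
have /card_gt_II/card_le_ordP[f finj Ff] : ~ (elements F #<= `I_k)%card.
  move=> Fk; apply: nF; split=> //; have [x Fx] := elements_neq0 F.
  by apply: (@injective_card_le _ 1 (fun=> x)) => // i j _; rewrite !ord1.
have [Q [cQ fQ Q0]] := disjoint_compact_nbhs _ _ lcX hX finj.
pose s := [seq Q i | i <- enum 'I_k.+1].
have cs P : P \in s -> compact P by move=> /mapP[i _ ->].
pose H := \bigcap_(P in [set` s]) hitting P.
have Hnull : lambda H = 0%E.
  have overlap0 : pairwise_overlap Q = set0.
    by rewrite -subset0 => x [[i j] /= /Q0 /seteqP[Q0ij _] /Q0ij].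
  have miss0 : ~` hitting (@set0 X) = setT.
    by apply/seteqP; split=> // G _ [x []].
  have s_neq0 : s != [::] by rewrite -size_eq0 size_map size_enum_ord.
  have := foldl_nabla1_measure _ _ lamPhi _ _ s_neq0 cs (@compact0 X).
  (* The empty base set is rewritten as the overlap of the disjoint [Q i], where the valuation
     property gives zero; missing the empty set is no condition. *)
  rewrite -[foldl _ _ _ _]/(nabla Q Phi set0) -[in LHS]overlap0 Phi_k //.
  by rewrite miss0 setTI => /esym/eqP; rewrite oppe_eq0 => /eqP.
(* [H] is Borel but need not be open, as the [Q i] are compact; [F] is in its interior because each
   [Q i] is a neighbourhood of a point of [F]. *)
exists H°; split; first exact: open_interior.
- suff : nbhs F [set G | forall i, hitting (Q i) G].
    by apply: filterS => G GQ P /= /mapP[i _ ->].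
  apply: (@filter_forall _ _ (fun i => hitting (Q i)) _ (nbhs_filter F)) => i.
  exact: hitting_nbhs (fQ i).
(* Choosing a point of [G] in each of the [k+1] disjoint sets [Q i] gives distinct points, too many
   for [Gk]. *)
- move=> G /interior_subset HG [_ Gk].
  have /choice[g Qg] i := HG (Q i) (map_f Q (mem_enum 'I_k.+1 i)).
  have ginj : injective g.
    move=> i j gij; apply: contrapT => /eqP /Q0; rewrite -subset0; apply.
    by split; [exact: (Qg i).1|rewrite gij; exact: (Qg j).1].
  have := card_le_trans (injective_card_le _ _ _ ginj (fun i => (Qg i).2)) Gk.
  by rewrite card_le_II ltnn.
- apply: (subset_measure0 _ _ _ Hnull).
  + by apply: open_Borel; exact: open_interior.
  + exact: hitting_all_Borel.
  + exact: interior_subset.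
Qed.

Theorem theorem1p2 (R : realType) (X : ptopologicalType)
    (X_locally_compact : locally_compact [set: X])
    (X_hausdorff : hausdorff_space X)
    (k : nat) (k_ge1 : (1 <= k)%N)
    (Phi : set X -> R) (Phi_capacity : capacity Phi)
    (Phi_valuation : k_valuation k Phi)
    (lambda : {measure set (g_sigma_algebraType (@open (closed_nonempty X)))
                 -> \bar R})
    (lambda_radon : radon lambda)
    (lambda_Phi : forall Q : set X, compact Q ->
       (Phi Q)%:E = lambda [set F : closed_nonempty X |
                             Q `&` elements F !=set0]) :
  lambda (~` card_1_to_k X k) = 0%E.
Proof.
have null F := more_than_k_null_nbhs k Phi lambda F X_locally_compact
  X_hausdorff Phi_valuation lambda_Phi.
apply: radon_open_locally_null => //.
- exact: fell_hausdorff.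
(* The complement is open because each null neighbourhood stays inside it. *)
- rewrite openE => F /null[V [oV VF Vk _]].
  by apply: filterS Vk _; apply: open_nbhs_nbhs.
- by move=> F /null[V [oV VF _ V0]]; exists V.
Qed.
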